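(* For a non-autonomous discrete dynamical system $(X,f_{1,\infty})$ the following are equivalent: (i) The system $(X,f_{1,\infty})$ is strongly extended transitive. (ii) For every opene set $U\subset X$ and every point $x\in X$, there exists $\alpha\in\Sigma$ such that $x\in f_\alpha(U)$. (iii) For every opene set $U\subset X$ and every point $x\in X$, the set $N_e(U,x)$ is nonempty. (iv) For every $x\in X$, the extended negative orbit $J^-(x)$ is dense in $X$. (v) For every $x\in X$ and every $\epsilon>0$, there exists a finite subset $\Sigma'\subset\Sigma$ such that $J^-_{\Sigma'}(x)$ is $\epsilon$ dense in $X$. (vi) If $U\subset X$ is nonempty and strong $-$ invariant, then $U$ is dense in $X$.
   Context: $\mathbb{N}=\{1,2,3,\dots\}$. A non-autonomous discrete dynamical system (NDDS) is a pair $(X,f_{1,\infty})$ where $X$ is a compact metric space and $f_{1,\infty}=(f_n)_{n\in\mathbb{N}}$ is a sequence of continuous maps $f_n:X\to X$. ''Opene'' means nonempty and open. $\Sigma=\{(n_1,\dots,n_p): p\in\mathbb{N},\ n_i\in\mathbb{N}\}$ is the set of finite (nonempty) words over $\mathbb{N}$, and for $\alpha=(n_1,\dots,n_p)\in\Sigma$, $f_\alpha:=f_{n_p}\circ\cdots\circ f_{n_1}$. $N_e(U,x)=\{\alpha\in\Sigma: f_\alpha(U)\cap\{x\}\neq\emptyset\}$. The extended negative orbit of $y\in X$ is $J^-(y)=\{x\in X: f_\alpha(x)=y\text{ for some }\alpha\in\Sigma\}$, and for nonempty $\Sigma'\subset\Sigma$, $J^-_{\Sigma'}(y)=\{x\in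 X: f_\alpha(x)=y\text{ for some }\alpha\in\Sigma'\}$. The system is strongly extended transitive if $\bigcup_{\alpha\in\Sigma}f_\alpha(V)=X$ for every opene $V\subset X$. A subset $A\subset X$ is strong $-$ invariant if $f_n^{-1}(A)\subset A$ for all $n\in\mathbb{N}$. For $\epsilon>0$, a subset of $X$ is $\epsilon$ dense if it intersects every open ball of radius $\epsilon$ in $X$. *)

(* Defs.v *)
From mathcomp Require Export all_boot all_order all_algebra.
From mathcomp Require Export boolp classical_sets functions cardinality reals.
From mathcomp Require Export topology.

Set Implicit Arguments.
Unset Strict Implicit.
Unset Printing Implicit Defensive.

Local Open Scope classical_set_scope.
Local Open Scope ring_scope.

(* The index set {1, 2, 3, ...}. *)
Definition pnat : Type := {n : nat | (0 < n)%N}.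

(* The set of nonempty finite words over [pnat]. *)
Definition Sigma : set (seq pnat) := [set a | a <> [::]].

(* The leftmost letter acts first:
   word_map f [:: n1; n2; n3] x = f n3 (f n2 (f n1 x)). *)
Definition word_map (X : Type) (f : pnat -> X -> X) (a : seq pnat) (x : X) : X :=
  foldl (fun y n => f n y) x a.

Definition opene (X : topologicalType) (U : set X) : Prop :=
  U !=set0 /\ open U.

Definition hitting_words (X : Type) (f : pnat -> X -> X) (U : set X) (x : X) :
    set (seq pnat) :=
  [set a | Sigma a /\ (word_map f a @` U) `&` [set x] !=set0].

Definition neg_orbit_in (X : Type) (f : pnat -> X -> X) (S : set (seq pnat))
    (y : X) : set X :=
  [set x | exists2 a, S a & word_map f a x = y].

Definition neg_orbit (X : Type) (f : pnat -> X -> X) (y : X) : set X :=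
  neg_orbit_in f Sigma y.

Definition strongly_extended_transitive (X : topologicalType)
    (f : pnat -> X -> X) : Prop :=
  forall V : set X, opene V ->
    \bigcup_(a in Sigma) (word_map f a @` V) = [set: X].

Definition strong_minus_invariant (X : Type) (f : pnat -> X -> X)
    (A : set X) : Prop :=
  forall n : pnat, f n @^-1` A `<=` A.

Definition eps_dense (R : realType) (X : metricType R) (eps : R)
    (A : set X) : Prop :=
  forall y : X, A `&` ball y eps !=set0.

(* Main.v *)
From HB Require Import structures.
From mathcomp Require Import finmap.
Require Import Defs.

Set Implicit Arguments.
Unset Strict Implicit.
Unset Printing Implicit Defensive.

Import Num.Theory.

Local Open Scope classical_set_scope.
Local Open Scope ring_scope.

(** For (iv) => (v), if [neg_orbit f x] meets [ball y eps] at [z], then [y] lies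
    in [ball z eps]; hence the open sets of points close to the fibre
    [word_map f a = x], indexed by the words [a], cover [X], and a finite
    subcover selects the finite set of words. For (vi) => (i), [neg_orbit f x]
    is strong minus invariant, so it is dense as soon as it is nonempty. If it
    were empty, [[set x]] would be strong minus invariant, hence dense, so [X]
    would be the single point [x], a fixed point lying in its own orbit. *)

(* [compact_cover] is stated for pointed spaces, hence the two cases below. *)
Lemma compact_finite_subset_cover (X : topologicalType) (K : set X)
    (I : choiceType) (D : set I) (V : I -> set X) :
  compact K -> (forall i, D i -> open (V i)) -> K `<=` cover D V ->
  finite_subset_cover D V K.
Proof.
have [->|/set0P[x _]] := eqVneq K set0 => [_ _ _|].
  by exists fset0 => // i; rewrite inE.
pose Y : ptopologicalType := HB.pack X (isPointed.Build X x).
(* [Y] carries the topology of [X], so compactness of [K] transfers by conversion. *)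
move=> K_compact; have: @compact Y K by [].
by rewrite compact_cover; apply.
Qed.

Lemma neg_orbit_minus_invariant (X : Type) (f : pnat -> X -> X) (y : X) :
  strong_minus_invariant f (neg_orbit f y).
Proof. by move=> n x [a _ <-]; exists (n :: a). Qed.

Lemma preimage_sub_neg_orbit (X : Type) (f : pnat -> X -> X) (n : pnat) (y : X) :
  f n @^-1` [set y] `<=` neg_orbit f y.
Proof. by move=> x fnx; exists [:: n]. Qed.

(** Induction on the word: invariance pulls membership in [U] back through one letter at a time, the
    last one first. *)
Lemma neg_orbit_in_sub_invariant (X : Type) (f : pnat -> X -> X)
    (S : set (seq pnat)) (U : set X) (y : X) :
  strong_minus_invariant f U -> U y -> neg_orbit_in f S y `<=` U.
Proof.
move=> Uinv Uy x [a _ ax]; rewrite -ax in Uy; move: Uy {ax}.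
by elim: a x => [//|n a IHa] x /IHa; exact: Uinv.
Qed.

Lemma neg_orbit_nonempty (X : topologicalType) (f : pnat -> X -> X) (x : X) :
  accessible_space X ->
  (forall U : set X, U !=set0 -> strong_minus_invariant f U -> dense U) ->
  neg_orbit f x !=set0.
Proof.
move=> X_T1 fdense; have [J0|/set0P//] := eqVneq (neg_orbit f x) set0.
have x_inv : strong_minus_invariant f [set x].
  by move=> n y fny; have := preimage_sub_neg_orbit fny; rewrite J0.
pose n : pnat := exist _ 1 isT.
(* Otherwise the complement of [x], open in a T1 space, contains [f n x] yet misses the dense set
   [[set x]]. *)
have fx : f n x = x.
  apply: contrapT => fx.
  have [|||y [yx xy]] := fdense [set x] _ x_inv (~` [set x]); last exact: yx xy.
  - by exists x.
  - by exists (f n x).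
  - exact/closed_openC/accessible_closed_set1.
by have := preimage_sub_neg_orbit fx; rewrite J0.
Qed.

Lemma finite_neg_orbit_eps_dense (R : realType) (X : metricType R)
    (f : pnat -> X -> X) (x : X) (eps : R) :
  compact [set: X] -> 0 < eps -> dense (neg_orbit f x) ->
  exists S : set (seq pnat),
    [/\ S `<=` Sigma, finite_set S & eps_dense eps (neg_orbit_in f S x)].
Proof.
move=> X_compact eps0 Jdense.
pose V (a : seq pnat) : set X :=
  \bigcup_(z in [set z | word_map f a z = x]) (ball z eps)^°.
have [a _|y _|S SSigma Scover] :=
    @compact_finite_subset_cover _ _ _ Sigma V X_compact.
- by apply: bigcup_open => z _; exact: open_interior.
(* Half the radius puts all of [ball y (eps / 2)] inside [ball z eps], so [y] is interior to the
   latter. *)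
- have [||z [/interior_subset yz [a aSigma az]]] := Jdense (ball y (eps / 2))^°.
  + by exists y; apply: nbhsx_ballx; rewrite divr_gt0.
  + exact: open_interior.
  exists a => //; exists z => //.
  apply/nbhs_ballP; exists (eps / 2) => /=; first by rewrite divr_gt0.
  by move=> t; apply: ball_split; exact: ball_sym.
- exists [set` S]; split=> [a /SSigma||y]; [by rewrite inE|exact: finite_fset|].
  have [a aS [z az /interior_subset zy]] := Scover y I.
  by exists z; split; [exists a|exact: ball_sym].
Qed.

Theorem theorem3p4 (R : realType) (X : metricType R)
    (X_compact : compact [set: X])
    (f : pnat -> X -> X) (f_continuous : forall n : pnat, continuous (f n)) :
  [<-> strongly_extended_transitive f;
       forall (U : set X) (x : X), opene U ->
         exists2 a, Sigma a & (word_map f a @` U) x;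
       forall (U : set X) (x : X), opene U -> hitting_words f U x !=set0;
       forall x : X, dense (neg_orbit f x);
       forall (x : X) (eps : R), 0 < eps ->
         exists S : set (seq pnat),
           [/\ S `<=` Sigma, finite_set S & eps_dense eps (neg_orbit_in f S x)];
       forall U : set X, U !=set0 -> strong_minus_invariant f U -> dense U].
Proof.
tfae.
- move=> ftrans U x /ftrans fU.
  by have : [set: X] x by []; rewrite -fU => -[a]; exists a.
- move=> fhit U x /(fhit _ x)[a aSigma aUx].
  by exists a; split=> //; exists x; split.
- move=> fhit x O O0 oO.
  by have [a [aSigma [_ [[z Oz <-] zx]]]] := fhit O x (conj O0 oO); exists z; split => //; exists a.
- by move=> Jdense x eps eps0; exact: finite_neg_orbit_eps_dense.
- move=> feps U [x Ux] Uinv O [y Oy] oO.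
  (* Only the scale of one ball around [y] inside [O] matters; the point found there is in [U],
     being in the negative orbit of [x]. *)
  have /nbhs_ballP[eps /= eps0 yO] : nbhs y O by exact: open_nbhs_nbhs.
  have [S [_ _ /(_ y)[z [Sz yz]]]] := feps x eps eps0.
  by exists z; split; [exact: yO|exact: neg_orbit_in_sub_invariant Sz].
- move=> fdense V [V0 oV]; apply/seteqP; split=> // x _.
  have J0 : neg_orbit f x !=set0.
    by apply: neg_orbit_nonempty => //; apply: hausdorff_accessible; exact: metric_hausdorff.
  have [z [Vz [a aSigma az]]] := fdense _ J0 (@neg_orbit_minus_invariant _ f x) V V0 oV.
  by exists a => //; exists z.
Qed.
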